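(* The class $\mathcal{I}$ of all inverse semigroups is an $\{\mathsf{E},\mathsf{H},\mathsf{P}\}$-class of semigroups, defined by the following equation system: a semigroup $S$ is an inverse semigroup if and only if for all $a,b\in S$ there exist $x,y\in S$ such that $x\in V(a)$, $y\in V(b)$, and $g_1g_2=g_2g_1$ for all $g_1,g_2\in\{ax,xa,by,yb\}$.
   Context: For a semigroup $S$ and $a\in S$, $V(a)=\{x\in S: axa=a,\ xax=x\}$ is the set of inverses of $a$. An inverse semigroup is a semigroup in which every element has exactly one inverse; equivalently, a regular semigroup (for every $a$ there is $x$ with $axa=a$) whose idempotents commute. The condition in the theorem is an equation system, i.e. a prenex first-order sentence in the language of one binary operation whose matrix is a finite conjunction of equalities of words. An $\{\mathsf{E},\mathsf{H},\mathsf{P}\}$-class is a class closed under $\mathsf{E}$ (if $A$ embeds elementarily in a member $B$ of the class, then $A$ is in the class), $\mathsf{H}$ (homomorphic images) and $\mathsf{P}$ (direct products). *)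

(* Defs.v *)
From HB Require Import structures.
From mathcomp Require Import all_boot monoid.
From mathcomp Require Import boolp classical_sets.

Set Implicit Arguments.
Unset Strict Implicit.
Unset Printing Implicit Defensive.

Import Algebra.

Local Open Scope group_scope.
Local Open Scope classical_set_scope.

Definition inverses (S : semigroupType) (a : S) : set S :=
  [set x | a * x * a = a /\ x * a * x = x].

Definition inverse_semigroup (S : semigroupType) : Prop :=
  forall a : S, exists! x, inverses a x.

(* First-order logic of one binary operation. A formula of type [formula n]
   has its free variables among 0, ..., n.-1, and a quantifier in it binds the
   variable n (de Bruijn levels), so a sentence is a [formula 0]. Keeping track
   of the number of variables makes satisfaction of sentences correct on the
   empty semigroup too, which has no assignment of values to all of nat. *)
Inductive word (n : nat) : Type :=
  | Var of 'I_n
  | Mul of word n & word n.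

Inductive formula (n : nat) : Type :=
  | Eq of word n & word n
  | Not of formula n
  | And of formula n & formula n
  | Or of formula n & formula n
  | Imp of formula n & formula n
  | All of formula n.+1
  | Ex of formula n.+1.

Fixpoint eval (S : semigroupType) n (e : 'I_n -> S) (w : word n) : S :=
  match w with
  | Var i => e i
  | Mul w1 w2 => eval e w1 * eval e w2
  end.

Definition extend (T : Type) n (e : 'I_n -> T) (x : T) (i : 'I_n.+1) : T :=
  if unlift ord_max i is Some j then e j else x.

Fixpoint sat (S : semigroupType) n (e : 'I_n -> S) (p : formula n) : Prop :=
  match p with
  | Eq w1 w2 => eval e w1 = eval e w2
  | Not q => ~ sat e q
  | And q r => sat e q /\ sat e r
  | Or q r => sat e q \/ sat e r
  | Imp q r => sat e q -> sat e r
  | All q => forall x : S, sat (extend e x) q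
  | Ex q => exists x : S, sat (extend e x) q
  end.

Definition models (S : semigroupType) (p : formula 0) : Prop :=
  forall e : 'I_0 -> S, sat e p.

Fixpoint equation_conjunction n (p : formula n) : bool :=
  match p with
  | Eq _ _ => true
  | And q r => equation_conjunction q && equation_conjunction r
  | _ => false
  end.

Fixpoint equation_system n (p : formula n) : bool :=
  match p with
  | All q | Ex q => equation_system q
  | _ => equation_conjunction p
  end.

Definition elementary_embedding (A B : semigroupType) (f : A -> B) : Prop :=
  forall n (p : formula n) (e : 'I_n -> A), sat e p <-> sat (f \o e) p.

Definition direct_product (I : Type) (S : I -> semigroupType) : Type :=
  forall i, S i.

Section DirectProduct.
Variables (I : Type) (S : I -> semigroupType).

HB.instance Definition _ := Choice.copy (direct_product S) (forall i, S i).

Definition direct_product_mul (x y : direct_product S) : direct_product S :=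
  fun i => x i * y i.

Lemma direct_product_mulA : associative direct_product_mul.
Proof.
by move=> x y z; apply: functional_extensionality_dep => i; exact: mulgA.
Qed.

HB.instance Definition _ :=
  isSemigroup.Build (direct_product S) direct_product_mulA.

End DirectProduct.

Section Closure.
Variable C : semigroupType -> Prop.

Definition closed_E : Prop :=
  forall (A B : semigroupType) (f : A -> B),
    elementary_embedding f -> C B -> C A.

Definition closed_H : Prop :=
  forall (A B : semigroupType) (f : {multiplicative A -> B}),
    (forall y : B, exists x : A, f x = y) -> C A -> C B.

Definition closed_P : Prop :=
  forall (I : Type) (S : I -> semigroupType),
    (forall i, C (S i)) -> C (direct_product S).

Definition EHP_class : Prop := [/\ closed_E, closed_H & closed_P].

End Closure.

(* forall a b, exists x y, axa = a, xax = x, byb = b, yby = y, and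
   g1 g2 = g2 g1 for all g1, g2 in {ax, xa, by, yb}. *)
Definition inverse_eqsys : formula 0 :=
  let a := Var (@Ordinal 4 0 isT) in
  let b := Var (@Ordinal 4 1 isT) in
  let x := Var (@Ordinal 4 2 isT) in
  let y := Var (@Ordinal 4 3 isT) in
  let gs := [:: Mul a x; Mul x a; Mul b y; Mul y b] in
  let commutations := [seq Eq (Mul g1 g2) (Mul g2 g1) | g1 <- gs, g2 <- gs] in
  All (All (Ex (Ex (foldr (@And 4)
    (And (And (Eq (Mul (Mul a x) a) a) (Eq (Mul (Mul x a) x) x))
         (And (Eq (Mul (Mul b y) b) b) (Eq (Mul (Mul y b) y) y)))
    commutations)))).

(* Main.v *)
Require Import Defs.
From mathcomp Require Import all_boot monoid.
From mathcomp Require Import boolp classical_sets.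

(** Everything rests on the classical fact that a semigroup is inverse iff it
is regular and its idempotents commute.  In an inverse semigroup the elements
[a * x], [x * a], [b * y], [y * b] are idempotents, hence commute; conversely,
when [a] and [b] are idempotents the condition of the theorem forces [x = a]
and [y = b], because [x = (x * a) * (a * x) = (a * x) * (x * a)] then absorbs
[a] on both sides, and so it says that [a] and [b] commute.

The condition is the meaning of the sentence [inverse_eqsys], and elementary
embeddings preserve sentences, which gives closure under [E].  It is a positive
condition, so it passes to homomorphic images, which gives closure under [H].
In a direct product inverses are computed coordinatewise, which gives closure
under [P]. *)

Set Implicit Arguments.
Unset Strict Implicit.
Unset Printing Implicit Defensive.

Local Open Scope group_scope.

Definition idempotent_elt (S : semigroupType) (e : S) : Prop := e * e = e.

(** * Inverse semigroups and commuting idempotents *)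

Lemma inverses_sym (S : semigroupType) (a x : S) :
  inverses a x -> inverses x a.
Proof. by case. Qed.

Lemma idempotent_inverses (S : semigroupType) (e : S) :
  idempotent_elt e -> inverses e e.
Proof. by move=> ee; split; rewrite ee ee. Qed.

Lemma inverses_idempotent (S : semigroupType) (a x : S) :
  inverses a x -> idempotent_elt (a * x).
Proof. by case=> axa _; rewrite /idempotent_elt mulgA axa. Qed.

Lemma inverses_unique (S : semigroupType) (a x y : S) :
  inverse_semigroup S -> inverses a x -> inverses a y -> x = y.
Proof. by move=> invS ax ay; have [z [_ uz]] := invS a; rewrite -(uz x) ?(uz y). Qed.

(** If [x] is the inverse of [e * f], then [f * x * e] is another one, so it
equals [x]; this makes [x] idempotent, hence its own inverse, while [e * f] is
also an inverse of [x]. *)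
Lemma inverse_semigroup_idempotentM (S : semigroupType) (e f : S) :
  inverse_semigroup S -> idempotent_elt e -> idempotent_elt f ->
  idempotent_elt (e * f).
Proof.
move=> invS ee ff.
have [x [efx _]] := invS (e * f); have [efxef xefx] := efx.
have fxeE : f * x * e = x.
  apply: (inverses_unique (a := e * f)) => //; split.
    rewrite -[RHS]efxef !mulgA -(mulgA e f f) ff.
    by rewrite -(mulgA (e * f * x) e e) ee.
  rewrite -[in RHS]xefx !mulgA -(mulgA (f * x) e e) ee.
  by rewrite -(mulgA (f * x * e) f f) ff.
have xx : idempotent_elt x.
  have : (f * x * e) * (f * x * e) = f * (x * (e * f) * x) * e by rewrite !mulgA.
  by rewrite xefx fxeE.
suff -> : e * f = x by [].
exact: inverses_unique invS (inverses_sym efx) (idempotent_inverses xx).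
Qed.

(** By the previous lemma [e * f] and [f * e] are idempotent, so both are
inverses of [e * f]. *)
Lemma inverse_semigroup_idempotentC (S : semigroupType) (e f : S) :
  inverse_semigroup S -> idempotent_elt e -> idempotent_elt f ->
  e * f = f * e.
Proof.
move=> invS ee ff.
have efef := inverse_semigroup_idempotentM invS ee ff.
have fefe := inverse_semigroup_idempotentM invS ff ee.
apply: (inverses_unique (a := e * f)) => //; first exact: idempotent_inverses.
split.
  rewrite -[RHS]efef !mulgA -(mulgA e f f) ff.
  by rewrite -(mulgA (e * f) e e) ee.
rewrite -[RHS]fefe !mulgA -(mulgA f e e) ee.
by rewrite -(mulgA (f * e) f f) ff.
Qed.

(** Two inverses [x] and [y] of [a] both equal [y * a * x]. *)
Lemma regular_idempotentC_inverse_semigroup (S : semigroupType) :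
  (forall a : S, exists x, inverses a x) ->
  (forall e f : S, idempotent_elt e -> idempotent_elt f -> e * f = f * e) ->
  inverse_semigroup S.
Proof.
move=> regS comS a; have [x ax] := regS a; exists x; split=> // y ay.
have [axa xax] := ax; have [aya yay] := ay.
have ix := inverses_idempotent ax.
have iy := inverses_idempotent ay.
have ix' := inverses_idempotent (inverses_sym ax).
have iy' := inverses_idempotent (inverses_sym ay).
transitivity (y * a * x).
  rewrite -[LHS]xax -[X in x * X * x]aya !mulgA -(mulgA (x * a) y a).
  by rewrite (comS _ _ ix' iy') -!mulgA (mulgA x a x) xax.
rewrite -[RHS]yay -[X in _ = y * X * y]axa !mulgA -(mulgA (y * a * x) a y).
by rewrite -(mulgA y a x) -(mulgA y _ (a * y)) (comS _ _ ix iy) !mulgA yay.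
Qed.

(** * The defining condition *)

Definition commuting_inverses (S : semigroupType) (a b x y : S) : Prop :=
  [/\ inverses a x, inverses b y
    & forall g1 g2 : S,
        g1 \in [:: a * x; x * a; b * y; y * b] ->
        g2 \in [:: a * x; x * a; b * y; y * b] ->
        g1 * g2 = g2 * g1].

(** The commutation of [x * e] with [e * x] makes the inverse [x] of the
idempotent [e] a two-sided multiple of [e]. *)
Lemma idempotent_commuting_inverse (S : semigroupType) (e x : S) :
  idempotent_elt e -> inverses e x -> (e * x) * (x * e) = (x * e) * (e * x) ->
  x = e.
Proof.
move=> ee [exe xex] exxe.
have xE : (e * x) * (x * e) = x.
  by rewrite exxe mulgA -(mulgA x e e) ee xex.
have ex : e * x = x by rewrite -{1}xE !mulgA ee -mulgA xE.
have xe : x * e = x by rewrite -{1}xE -!mulgA ee mulgA xE.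
by rewrite -exe ex xe.
Qed.

Lemma inverse_semigroupP (S : semigroupType) :
  inverse_semigroup S <->
  forall a b : S, exists x y : S, commuting_inverses a b x y.
Proof.
split=> [invS a b | condS].
  have [x [ax _]] := invS a; have [y [bY _]] := invS b.
  exists x, y; split=> //.
  have idem g : g \in [:: a * x; x * a; b * y; y * b] -> idempotent_elt g.
    rewrite !inE => /or4P[] /eqP->; apply: inverses_idempotent => //;
      exact: inverses_sym.
  by move=> g h /idem gg /idem hh; apply: inverse_semigroup_idempotentC.
apply: regular_idempotentC_inverse_semigroup => [a | e f ee ff].
  by have [x [_ [ax _ _]]] := condS a a; exists x.
have [x [y [ex fy com]]] := condS e f.
have xE : x = e.
  by apply: idempotent_commuting_inverse => //; apply: com; rewrite !inE eqxx ?orbT.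
have yE : y = f.
  by apply: idempotent_commuting_inverse => //; apply: com; rewrite !inE eqxx ?orbT.
by move: com; rewrite xE yE ee ff; apply; rewrite !inE eqxx ?orbT.
Qed.

(** * The defining sentence *)

(** The formulas use de Bruijn levels, so a new quantifier binds the largest
index and leaves the values of the smaller ones unchanged. *)
Lemma extend_max (T : Type) n (e : 'I_n -> T) x : extend e x ord_max = x.
Proof. by rewrite /extend unlift_none. Qed.

Lemma extend_lift (T : Type) n (e : 'I_n -> T) x j :
  extend e x (lift ord_max j) = e j.
Proof. by rewrite /extend liftK. Qed.

Lemma extend_ltn (T : Type) n (e : 'I_n -> T) x i (lt_in1 : i < n.+1)
    (lt_in : i < n) :
  extend e x (Ordinal lt_in1) = e (Ordinal lt_in).
Proof.
rewrite -(extend_lift e x); congr (extend e x _).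
by apply: val_inj; rewrite /= /bump leqNgt lt_in.
Qed.

Lemma extend_eqn (T : Type) n (e : 'I_n -> T) x (lt_nn1 : n < n.+1) :
  extend e x (Ordinal lt_nn1) = x.
Proof. by rewrite -[RHS](extend_max e); congr extend; apply: val_inj. Qed.

Lemma models_inverse_eqsys (S : semigroupType) :
  models S inverse_eqsys <->
  forall a b : S, exists x y : S, commuting_inverses a b x y.
Proof.
have env (e : 'I_0 -> S) a b x y (e4 := extend (extend (extend (extend e a) b) x) y) :
    [/\ e4 (@Ordinal 4 0 isT) = a, e4 (@Ordinal 4 1 isT) = b,
        e4 (@Ordinal 4 2 isT) = x & e4 (@Ordinal 4 3 isT) = y].
  by split; rewrite /e4; do ?[rewrite extend_eqn // | rewrite extend_ltn //].
split=> [modS a b | condS e].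
  pose e0 (i : 'I_0) : S := False_rect S (notF (ltn_ord i)).
  have [x [y]] := modS e0 a b.
  rewrite /=; case: (env e0 a b x y) => -> -> -> -> com; exists x, y.
  have [ax bY] : inverses a x /\ inverses b y by rewrite /inverses /=; tauto.
  split=> // g h; rewrite !inE.
  by case/or4P=> /eqP-> /or4P[] /eqP->; tauto.
rewrite /= => a b; have [x [y [ax bY com]]] := condS a b; exists x, y.
case: (env e a b x y) => -> -> -> ->.
(* one conjunct for each pair of the four idempotents, then the inverses *)
by do 16!(split; first by apply: com; rewrite !inE eqxx ?orbT).
Qed.

Lemma inverse_semigroup_models (S : semigroupType) :
  inverse_semigroup S <-> models S inverse_eqsys.
Proof. by rewrite models_inverse_eqsys; exact: inverse_semigroupP. Qed.

(** * Closure properties *)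

Lemma elementary_embedding_models (A B : semigroupType) (f : A -> B) p :
  elementary_embedding f -> models B p -> models A p.
Proof. by move=> emb modB e; apply/emb/modB. Qed.

Lemma inverse_semigroup_closed_E : closed_E inverse_semigroup.
Proof.
move=> A B f emb /inverse_semigroup_models modB.
exact/inverse_semigroup_models/(elementary_embedding_models emb).
Qed.

Lemma morph_inverses (A B : semigroupType) (f : {multiplicative A -> B}) a x :
  inverses a x -> inverses (f a) (f x).
Proof. by case=> axa xax; split; rewrite -!gmulfM ?axa ?xax. Qed.

(** Unlike uniqueness of inverses, the defining condition transports along a
surjective morphism directly: the witnesses are the images of witnesses. *)
Lemma inverse_semigroup_closed_H : closed_H inverse_semigroup.
Proof.
move=> A B f surj_f /inverse_semigroupP condA; apply/inverse_semigroupP=> c d.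
have [[a <-] [b <-]] := (surj_f c, surj_f d).
have [x [y [ax bY com]]] := condA a b; exists (f x), (f y).
split; [exact: morph_inverses | exact: morph_inverses |].
have -> : [:: f a * f x; f x * f a; f b * f y; f y * f b] =
          map f [:: a * x; x * a; b * y; y * b] by rewrite /= !gmulfM.
by move=> _ _ /mapP[g gs ->] /mapP[h hs ->]; rewrite -!gmulfM com.
Qed.

Lemma inverses_direct_product (I : Type) (S : I -> semigroupType)
    (a x : direct_product S) :
  inverses a x <-> forall i, inverses (a i) (x i).
Proof.
split=> [[axa xax] i | ax].
  by split; [have := congr1 (@^~ i) axa | have := congr1 (@^~ i) xax].
by split; apply: functional_extensionality_dep => i; case: (ax i).
Qed.

Lemma inverse_semigroup_closed_P : closed_P inverse_semigroup.
Proof.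
move=> I S invS a.
have [x xP] : exists x : forall i, S i,
    forall i, unique (inverses (a i)) (x i).
  by exists (fun i => sval (cid (invS i (a i)))) => i; exact: svalP.
exists (x : direct_product S); split=> [|y /inverses_direct_product ay].
  by apply/inverses_direct_product => i; have [] := xP i.
apply: functional_extensionality_dep => i.
by have [_ ux] := xP i; exact/ux/ay.
Qed.

Theorem theorem4p3 :
  [/\ EHP_class inverse_semigroup,
      equation_system inverse_eqsys,
      forall S : semigroupType, inverse_semigroup S <-> models S inverse_eqsys
    & forall S : semigroupType, inverse_semigroup S <->
        forall a b : S, exists x y : S,
          [/\ inverses a x,
              inverses b y
            & forall g1 g2 : S,
                g1 \in [:: a * x; x * a; b * y; y * b] ->
                g2 \in [:: a * x; x * a; b * y; y * b] ->
                g1 * g2 = g2 * g1]].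
Proof.
split; [split | by [] | exact: inverse_semigroup_models
  | exact: inverse_semigroupP].
- exact: inverse_semigroup_closed_E.
- exact: inverse_semigroup_closed_H.
- exact: inverse_semigroup_closed_P.
Qed.
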